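(* Let $\varrho$ be a partition of the interval $[a,b]$ and suppose $G\in\mathcal C^4([a,b])$. Let $F$ be the clamped cubic spline interpolating $G$ on $\varrho$. Let $\hat F$ and $\hat G$ be the least concave majorants of $F$ and $G$ on $[a,b]$, and put $f=F'$, $g=G'$, $f^\circ=(\hat F)'$, $g^\circ=(\hat G)'$. Then $$\|f^\circ-g^\circ\|_\infty\le\|f-g\|_\infty\le\frac1{24}\,\|G^{(4)}\|_\infty\,\|\varrho\|^3,$$ and for each $x\in[a,b]$, $$|\hat F(x)-\hat G(x)|\le\frac{\min\{x-a,\,b-x\}}{24}\,\|G^{(4)}\|_\infty\,\|\varrho\|^3 .$$
   Context: For a continuous function $F$ on $[a,b]$ the least concave majorant is $\hat F(x)=\inf\{H(x): H\ge F\text{ on }[a,b],\ H\text{ concave}\}$. A partition $\varrho=[x_0,\dots,x_{n+1}]$ of $[a,b]$ satisfies $a=x_0<x_1<\dots<x_{n+1}=b$, and its mesh is $\|\varrho\|=\max_{1\le k\le n+1}|x_k-x_{k-1}|$. The clamped cubic spline interpolating $G$ on $\varrho$ is the unique $F\in\mathcal C^2([a,b])$ that is a polynomial of degree at most three on each $[x_{k-1},x_k]$, satisfies $F(x_k)=G(x_k)$ for $k=0,\dots,n+1$, and $F'(a)=G'(a)$, $F'(b)=G'(b)$. $\|\cdot\|_\infty$ denotes the (essential) supremum norm on $[a,b]$. *)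

(* Defs.v *)
From HB Require Import structures.
From mathcomp Require Import all_boot all_order all_algebra.
From mathcomp Require Import all_classical all_reals all_analysis.

Set Implicit Arguments.
Unset Strict Implicit.
Unset Printing Implicit Defensive.

Import Order.TTheory GRing.Theory Num.Def Num.Theory.
Import numFieldNormedType.Exports.

Local Open Scope classical_set_scope.
Local Open Scope ring_scope.

(* A function on [a, b] is a total function R -> R whose values outside [a, b]
   are never used. Hence derivatives are taken within [a, b]: two-sided at
   interior points, one-sided at the endpoints. *)

Definition derivable_within (R : realType) (A : set R) (f : R -> R) (x : R) :
    Prop :=
  cvg ((fun t => (f t - f x) / (t - x)) @ within A x^').

Definition derive_within (R : realType) (A : set R) (f : R -> R) (x : R) : R :=
  lim ((fun t => (f t - f x) / (t - x)) @ within A x^').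

Definition derive_withinn (R : realType) (A : set R) (n : nat) (f : R -> R) :
    R -> R :=
  iter n (derive_within A) f.

(* Continuity of the derivatives of order less than k follows from their
   derivability. *)
Definition Ck (R : realType) (k : nat) (a b : R) (f : R -> R) : Prop :=
  (forall i x, (i < k)%N -> x \in `[a, b] ->
     derivable_within `[a, b] (derive_withinn `[a, b] i f) x) /\
  {within `[a, b], continuous (derive_withinn `[a, b] k f)}.

Definition concave_on (R : realType) (a b : R) (H : R -> R) : Prop :=
  convex_function (`[a, b]%classic : set R) (\- H : R -> R).

(* For x in [a, b] and F bounded on [a, b], the set below is nonempty and
   bounded below by F x, so that [inf] is the true infimum. *)
Definition least_concave_majorant (R : realType) (a b : R) (F : R -> R)
    (x : R) : R :=
  inf [set H x | H in [set H : R -> R |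
    (forall t, t \in `[a, b] -> F t <= H t) /\ concave_on a b H]].

(* As in [itv_partition a b s], a partition a = x_0 < x_1 < ... < x_{n+1} = b is
   encoded by the sequence s = [:: x_1; ...; x_{n+1}]. *)
Definition node (R : realType) (a b : R) (s : seq R) (k : nat) : R :=
  nth b (a :: s) k.

Definition mesh (R : realType) (a b : R) (s : seq R) : R :=
  \big[Num.max/0]_(0 <= k < size s) `|node a b s k.+1 - node a b s k|.

Definition clamped_cubic_spline (R : realType) (a b : R) (s : seq R)
    (G F : R -> R) : Prop :=
  [/\ Ck 2 a b F,
      forall k, (k < size s)%N -> exists2 p : {poly R}, (size p <= 4)%N &
        forall t, t \in `[node a b s k, node a b s k.+1] -> F t = p.[t],
      forall k, (k <= size s)%N -> F (node a b s k) = G (node a b s k),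
      derive_within `[a, b] F a = derive_within `[a, b] G a &
      derive_within `[a, b] F b = derive_within `[a, b] G b].

(* The restriction [f \_ D] extends f by 0 outside D, which does not affect the
   essential supremum of `|f|. *)
Definition supnorm (R : realType) (a b : R) (f : R -> R) : \bar R :=
  'N[@lebesgue_measure R]_+oo [EFin \o (f \_ `[a, b])].

(* Main.v *)
Require Import Defs.
From HB Require Import structures.
From mathcomp Require Import all_boot all_order all_algebra.
From mathcomp Require Import all_classical all_reals all_analysis.
From mathcomp Require Import ess_sup_inf.
From mathcomp Require Import ring lra.

Set Implicit Arguments.
Unset Strict Implicit.
Unset Printing Implicit Defensive.

Import Order.TTheory GRing.Theory Num.Def Num.Theory.
Import numFieldNormedType.Exports.

Local Open Scope classical_set_scope.
Local Open Scope ring_scope.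

(** Write v = f - g for the slope error and m for the maximum of |v|.

    The first inequality is a comparison principle for least concave majorants
    ([lcm_increment_le]): if H - F is nondecreasing, then so is the difference
    of the majorants of H and F. Given x < y, let p be a supergradient of the
    majorant of F at x and q one of the majorant of H at y. When p <= q the two
    tangent lines give the claim. When p > q, the tangent lines and the
    monotonicity of H - F bound F t + H s by an affine function of t + s plus
    (p - q) min(t, s). That bound is concave in t for fixed s and in s for
    fixed t, so F and then H may be replaced by their majorants; at (t, s) =
    (y, x) it is the claim. Taking H = G + m t, whose majorant is that of G
    plus m t, the slopes of the two majorants differ by at most m wherever they
    exist, and they exist at every interior point because the majorant of a
    differentiable function cannot have a corner ([lcm_supergradient_nlt]).

    The bound on m comes from a maximum principle on a single piece, instead of
    the linear system for the slopes of the spline. Let M bound |G''''| and let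
    |v| attain its maximum at xi, say with v xi = m > 0. As v vanishes at a and
    b, xi is interior and v' xi = 0. Take a piece [al, be] of the partition that
    contains xi. There the fourth derivative of e = F - G is that of - G, and e
    vanishes at both ends. Expanding e at xi, the equation e be = e al relates
    m to c = e''' xi, and v >= - m at the end farther from xi bounds - c. The
    combination of the two remainders has a kernel of constant sign, which
    gives m <= M (be - al)^3 / 24 ([far_end_bound],
    [interior_max_bound]).

    For the last inequality, F and G agree at a and b, so F <= G + m (t - a) and
    F <= G + m (b - t), and affine functions pass through the majorants
    ([lcmD_affine_le]). *)

(** * Derivatives within a set *)

(** The relational form of [derive_within]: it asserts existence together with
    the value, whereas [derive_within] is unspecified where the difference
    quotients diverge. *)
Definition has_derive_within (R : realType) (A : set R) (f : R -> R) (x l : R) :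
    Prop :=
  (fun t => (f t - f x) / (t - x)) @ within A x^' --> l.

(** Multiplying out the quotient removes the condition that t differs from x;
    the estimates below then need no case distinction. *)
Lemma has_derive_withinP (R : realType) (A : set R) (f : R -> R) (x l : R) :
  has_derive_within A f x l <->
  forall e, 0 < e -> exists2 d, 0 < d & forall t, A t -> `|t - x| < d ->
    `|f t - f x - l * (t - x)| <= e * `|t - x|.
Proof.
rewrite /has_derive_within; split.
- move/cvgrPdist_le => h e e0.
  have := h _ e0; rewrite near_withinE.
  rewrite /dnbhs near_withinE.
  move=> /nbhs_ballP[d /= d0 hd]; exists d => // t At tx.
  have [->|tneq] := eqVneq t x; first by rewrite !subrr mulr0 subrr normr0 mulr0.
  have tx0 : t - x != 0 by rewrite subr_eq0.
  have := hd t; rewrite /ball/= distrC => /(_ tx tneq At).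
  rewrite distrC => ineq.
  rewrite (_ : f t - f x - l * (t - x) =
    ((f t - f x) / (t - x) - l) * (t - x)); last by field.
  by rewrite normrM ler_wpM2r.
- move=> h; apply/cvgrPdist_le => e e0.
  have [d d0 hd] := h _ e0.
  rewrite !near_withinE.
  apply/nbhs_ballP; exists d => //= t; rewrite /ball/= distrC => tx tneq At.
  have tx0 : t - x != 0 by rewrite subr_eq0.
  have := hd _ At tx.
  rewrite (_ : f t - f x - l * (t - x) =
    ((f t - f x) / (t - x) - l) * (t - x)); last by field.
  by rewrite normrM ler_pM2r ?normr_gt0// distrC.
Qed.

Lemma is_derive_has_derive_within (R : realType) (A : set R) (f : R -> R) (x l : R) :
  is_derive x 1 f l -> has_derive_within A f x l.
Proof.
move=> [/cvg_ex[m hm] fl].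
have : m = l by rewrite -fl; apply/esym/cvg_lim.
move=> ml; move: hm; rewrite ml => /cvgrPdist_le hl.
apply/has_derive_withinP => e e0.
have := hl _ e0; rewrite near_withinE.
move=> /nbhs_ballP[d /= d0 hd]; exists d => // t At tx.
have [->|tneq] := eqVneq t x; first by rewrite !subrr mulr0 subrr normr0 mulr0.
have tx0 : t - x != 0 by rewrite subr_eq0.
have := hd (t - x); rewrite /ball/= sub0r normrN => /(_ tx tx0).
rewrite /GRing.scale/= mulr1 subrK distrC => ineq.
rewrite (_ : f t - f x - l * (t - x) =
  ((t - x)^-1 * (f t - f x) - l) * (t - x)); last by field.
by rewrite normrM ler_wpM2r.
Qed.

Lemma has_derive_within_is_derive (R : realType) (A : set R) (f : R -> R) (x l : R) :
  nbhs x A -> has_derive_within A f x l -> is_derive x 1 f l.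
Proof.
move=> /nbhs_ballP[r /= r0 rA] /has_derive_withinP h.
have lim : h^-1 *: (f (h *: (1:R) + x) - f x) @[h --> 0^'] --> l.
  apply/cvgrPdist_le => e e0; have [d d0 hd] := h _ e0.
  rewrite near_withinE; apply/nbhs_ballP.
  exists (Num.min d r) => /=; first by rewrite lt_min d0.
  move=> t; rewrite /ball/= sub0r normrN lt_min => /andP[td tr] t0.
  have := hd (t + x); rewrite addrK => /(_ _ td).
  rewrite /GRing.scale/= mulr1 => ineq.
  have {}ineq : `|f (t + x) - f x - l * t| <= e * `|t|.
    by apply: ineq; apply: rA; rewrite /ball/= opprD addrCA subrr addr0 normrN.
  move: ineq; rewrite (_ : f (t + x) - f x - l * t =
    (t^-1 * (f (t + x) - f x) - l) * t); last by field.
  by rewrite normrM ler_pM2r ?normr_gt0// distrC.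
by split; [apply/cvg_ex; exists l|exact/cvg_lim].
Qed.

Lemma has_derive_within_continuous (R : realType) (A : set R) (f f' : R -> R) :
  (forall x, A x -> has_derive_within A f x (f' x)) -> {within A, continuous f}.
Proof.
move=> h; apply/subspace_continuousP => x Ax; apply/cvgrPdist_le => e e0.
have /has_derive_withinP/(_ 1 ltr01)[d d0 hd] := h x Ax.
set c := 1 + `|f' x|.
have c0 : 0 < c by rewrite /c ltr_wpDr.
rewrite near_withinE; apply/nbhs_ballP.
exists (Num.min d (e / c)) => /=; first by rewrite lt_min d0 divr_gt0.
move=> t; rewrite /ball/= distrC lt_min => /andP[td te] At.
have := hd t At td; rewrite mul1r => ineq.
have : `|f t - f x| <= c * `|t - x|.
  rewrite -[f t - f x](subrK (f' x * (t - x))) (le_trans (ler_normD _ _))//.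
  by rewrite /c mulrDl mul1r lerD// normrM.
rewrite distrC => /le_trans; apply; rewrite mulrC -ler_pdivlMr//.
exact: ltW.
Qed.

Lemma has_derive_within_subset (R : realType) (A B : set R) (f : R -> R) (x l : R) :
  B `<=` A -> has_derive_within A f x l -> has_derive_within B f x l.
Proof.
move=> BA /has_derive_withinP h; apply/has_derive_withinP => e /h[d d0 hd].
by exists d => // t /BA; exact: hd.
Qed.

Lemma eq_has_derive_within (R : realType) (A : set R) (f g : R -> R) (x l : R) :
  {in A, f =1 g} -> A x -> has_derive_within A f x l ->
  has_derive_within A g x l.
Proof.
move=> fg Ax /has_derive_withinP h; apply/has_derive_withinP => e /h[d d0 hd].
by exists d => // t At td; rewrite -!fg ?inE//; exact: hd.
Qed.

Lemma has_derive_withinD (R : realType) (A : set R) (f g : R -> R) (x l m : R) :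
  has_derive_within A f x l -> has_derive_within A g x m ->
  has_derive_within A (f \+ g) x (l + m).
Proof.
move=> hf hg; rewrite /has_derive_within.
rewrite (_ : (fun t => _) =
  (fun t => (f t - f x) / (t - x)) \+ (fun t => (g t - g x) / (t - x))).
  exact: cvgD.
by apply/funext => t /=; rewrite -mulrDl; congr (_ / _); ring.
Qed.

Lemma has_derive_withinN (R : realType) (A : set R) (f : R -> R) (x l : R) :
  has_derive_within A f x l -> has_derive_within A (\- f) x (- l).
Proof.
move=> hf; rewrite /has_derive_within.
rewrite (_ : (fun t => _) = - (fun t => (f t - f x) / (t - x))).
  exact: cvgN.
by apply/funext => t /=; rewrite fctE -mulNr; congr (_ / _); ring.
Qed.

Lemma has_derive_withinB (R : realType) (A : set R) (f g : R -> R) (x l m : R) :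
  has_derive_within A f x l -> has_derive_within A g x m ->
  has_derive_within A (f \- g) x (l - m).
Proof. by move=> hf hg; exact/has_derive_withinD/has_derive_withinN. Qed.

Lemma has_derive_within_affine (R : realType) (A : set R) (k q x : R) :
  has_derive_within A (fun t => k + q * t) x q.
Proof.
apply/has_derive_withinP => e e0; exists 1 => // t _ _.
by rewrite (_ : k + _ - _ - _ = 0) ?normr0 ?mulr_ge0// ?(ltW e0)//; ring.
Qed.

Lemma has_derive_within_comp_affine (R : realType) (A B : set R)
    (f : R -> R) (c s x l : R) :
  (forall t, B t -> A (c + s * t)) -> has_derive_within A f (c + s * x) l ->
  has_derive_within B (fun t => f (c + s * t)) x (s * l).
Proof.
move=> BA /has_derive_withinP h; apply/has_derive_withinP => e e0.
have s0 : 0 < `|s| + 1 by rewrite ltr_wpDl.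
have [d d0 hd] := h (e / (`|s| + 1)) (divr_gt0 e0 s0).
exists (d / (`|s| + 1)); first by rewrite divr_gt0.
move=> t Bt; rewrite ltr_pdivlMr// => td.
have E : c + s * t - (c + s * x) = s * (t - x) by ring.
have := hd _ (BA _ Bt); rewrite E normrM => hdt.
rewrite (_ : s * l * (t - x) = l * (s * (t - x))); last by ring.
apply: le_trans (hdt _) _.
  by apply: le_lt_trans td; rewrite mulrC ler_wpM2l// lerDl.
rewrite mulrA ler_wpM2r// -mulrA ler_piMr//; first exact: ltW.
by rewrite mulrC ler_pdivrMr// mul1r lerDl.
Qed.

(** This is what makes limits of difference quotients unique, at the ends of
    the interval as well as inside. *)
Lemma within_dnbhs_proper (R : realType) (a b x : R) : a < b -> x \in `[a, b] ->
  ProperFilter (within `[a, b]%classic x^').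
Proof.
move=> ab; rewrite in_itv/= => /andP[ax xb].
apply: Build_ProperFilter_ex => P; rewrite /within /=.
move=> /nbhs_ballP[d /= d0 hd].
have [xltb|bx] := ltP x b.
- exists (x + Num.min (d / 2) (b - x)).
  have m0 : 0 < Num.min (d / 2) (b - x) by rewrite lt_min divr_gt0//= subr_gt0.
  have md : Num.min (d / 2) (b - x) < d by rewrite gt_min gtr_pMr// invf_lt1// ltr1n.
  have mb : Num.min (d / 2) (b - x) <= b - x by rewrite ge_min lexx orbT.
  move: m0 md mb; set m := Num.min _ _ => m0 md mb.
  apply: hd.
  + by rewrite /ball/= opprD addrA subrr sub0r normrN gtr0_norm.
  + by rewrite -subr_eq0 addrAC subrr add0r gt_eqF.
  + by rewrite /= in_itv/=; apply/andP; split; lra.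
- exists (x - Num.min (d / 2) (x - a)).
  have m0 : 0 < Num.min (d / 2) (x - a) by rewrite lt_min divr_gt0//= subr_gt0; lra.
  have md : Num.min (d / 2) (x - a) < d by rewrite gt_min gtr_pMr// invf_lt1// ltr1n.
  have mb : Num.min (d / 2) (x - a) <= x - a by rewrite ge_min lexx orbT.
  move: m0 md mb; set m := Num.min _ _ => m0 md mb.
  apply: hd.
  + by rewrite /ball/= opprB addrCA subrr addr0 gtr0_norm.
  + by rewrite -subr_eq0 addrAC subrr add0r oppr_eq0 gt_eqF.
  + by rewrite /= in_itv/=; apply/andP; split; lra.
Qed.

Lemma has_derive_withinE (R : realType) (a b x : R) (f : R -> R) (l : R) :
  a < b -> x \in `[a, b] -> has_derive_within `[a, b] f x l ->
  derive_within `[a, b] f x = l.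
Proof.
move=> ab xab h; have := within_dnbhs_proper ab xab => pf.
exact: cvg_lim h.
Qed.

Lemma has_derive_within_unique (R : realType) (a b x : R) (f : R -> R) (l m : R) :
  a < b -> x \in `[a, b] -> has_derive_within `[a, b] f x l ->
  has_derive_within `[a, b] f x m -> l = m.
Proof.
by move=> ab xab /(has_derive_withinE ab xab) <- /(has_derive_withinE ab xab).
Qed.

(** The mean value theorem, transferred to derivatives taken within the
    interval. *)
Lemma has_derive_within_ge0_homo (R : realType) (a b : R) (f f' : R -> R) :
  (forall x, x \in `[a, b] -> has_derive_within `[a, b] f x (f' x)) ->
  (forall x, x \in `[a, b] -> 0 <= f' x) ->
  {in `[a, b] &, {homo f : x y / x <= y}}.
Proof.
move=> hf f'0 x y; rewrite !in_itv/= => /andP[ax xb] /andP[ay yb] xy.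
have oo t : t \in `]x, y[ -> is_derive t 1 f (f' t).
  move=> txy; have tab : t \in `]a, b[.
    by move: txy; rewrite !in_itv/= => /andP[? ?]; apply/andP; split; lra.
  apply: (@has_derive_within_is_derive _ `[a, b]).
    by apply: filterS (near_in_itvoo tab) => z; exact: subset_itv_oo_cc.
  by apply: hf; exact: subset_itv_oo_cc tab.
have cf : {within `[x, y], continuous f}.
  apply: (has_derive_within_continuous (f' := f')) => t /= txy.
  have tab : t \in `[a, b].
    by move: txy; rewrite !in_itv/= => /andP[? ?]; apply/andP; split; lra.
  apply: has_derive_within_subset (hf _ tab).
  by move=> s /=; rewrite !in_itv/= => /andP[? ?]; apply/andP; split; lra.
have [c cxy] := MVT_segment xy oo cf.
rewrite -subr_ge0 => ->; rewrite mulr_ge0// ?subr_ge0//; apply: f'0.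
by move: cxy; rewrite !in_itv/= => /andP[? ?]; apply/andP; split; lra.
Qed.

(** The derivative is again written in the quartic shape, so that the lemma
    applies repeatedly along a chain of derivatives. *)
Lemma has_derive_within_quartic (R : realType) (A : set R) (c0 c1 c2 c3 c4 x : R) :
  has_derive_within A
    (fun t => c0 + c1 * t + c2 * t ^+ 2 + c3 * t ^+ 3 + c4 * t ^+ 4) x
    (c1 + (2 * c2) * x + (3 * c3) * x ^+ 2 + (4 * c4) * x ^+ 3 + 0 * x ^+ 4).
Proof.
apply: is_derive_has_derive_within.
pose p : {poly R} := c0%:P + c1 *: 'X + c2 *: 'X^2 + c3 *: 'X^3 + c4 *: 'X^4.
have := is_derive_poly p x.
rewrite (_ : horner p =
  (fun t => c0 + c1 * t + c2 * t ^+ 2 + c3 * t ^+ 3 + c4 * t ^+ 4)); last first.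
  by apply/funext => t; rewrite /p !hornerE.
rewrite (_ : p^`().[x] = c1 + (2 * c2) * x + (3 * c3) * x ^+ 2 +
  (4 * c4) * x ^+ 3 + 0 * x ^+ 4)//.
rewrite /p !poly.derivE/= !hornerE/=. ring.
Qed.

(** The one case of the product rule that the kernel argument of [chain4_ge0]
    uses. *)
Lemma has_derive_within_mulid (R : realType) (A : set R) (f : R -> R) (x l : R) :
  has_derive_within A f x l ->
  has_derive_within A (fun t => t * f t) x (x * l + f x).
Proof.
move=> h; rewrite /has_derive_within.
have hid : t @[t --> within A x^'] --> x.
  by apply: cvg_within_filter; exact: cvg_within.
have lim := cvgD (cvgM hid h) (cvg_cst (f x) (F := within A x^')).
refine (cvg_trans _ (lim _ _ _)); apply: near_eq_cvg.
rewrite near_withinE near_withinE; apply: nearW => t tx _ /=.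
have tx0 : t - x != 0 by rewrite subr_eq0.
by rewrite !fctE /=; field.
Qed.

Lemma has_derive_withinZ (R : realType) (A : set R) (f : R -> R) (c x l : R) :
  has_derive_within A f x l -> has_derive_within A (fun t => c * f t) x (c * l).
Proof.
move=> h; rewrite /has_derive_within.
rewrite (_ : (fun t => _) = (fun t => c * ((f t - f x) / (t - x)))).
  exact: cvgMr h.
by apply/funext => t /=; rewrite mulrA mulrBr.
Qed.

Lemma derive_ge0_ge0 (R : realType) (q : R) (S S' : R -> R) :
  (forall t, t \in `[0, q] -> has_derive_within `[0, q] S t (S' t)) ->
  S 0 = 0 -> (forall t, t \in `[0, q] -> 0 <= S' t) ->
  forall t, t \in `[0, q] -> 0 <= S t.
Proof.
move=> hS S0 S'0 t tq; rewrite -S0; apply: (has_derive_within_ge0_homo hS S'0) => //.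
- by move: tq; rewrite !in_itv/= => /andP[? ?]; apply/andP; split; lra.
- by move: tq; rewrite !in_itv/= => /andP[? ?].
Qed.

Lemma has_derive_within_ge0 (R : realType) (a b x l : R) (phi : R -> R) :
  x \in `]a, b[ -> has_derive_within `[a, b] phi x l ->
  (forall t, t \in `]a, b[ -> x < t -> phi x <= phi t) -> 0 <= l.
Proof.
rewrite in_itv/= => /andP[ax xb] /has_derive_withinP d mono.
rewrite leNgt; apply/negP => l0; have e0 : 0 < - l / 2 by lra.
have [r r0 hr] := d _ e0.
pose h := Num.min (r / 2) ((b - x) / 2).
have h0 : 0 < h by rewrite lt_min !divr_gt0// subr_gt0.
have hr' : h < r by rewrite gt_min; apply/orP; left; lra.
have hb : h <= (b - x) / 2 by rewrite ge_min lexx orbT.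
have tab : x + h \in `]a, b[ by rewrite in_itv/=; apply/andP; split; lra.
have E : x + h - x = h by ring.
have := hr _ (subset_itv_oo_cc tab); rewrite E gtr0_norm// => /(_ hr').
rewrite ler_norml => /andP[_ up].
have := mono _ tab; rewrite ltrDl => /(_ h0) low.
have : 0 < - l * h by rewrite mulr_gt0// oppr_gt0.
lra.
Qed.

Lemma increment_le (R : realType) (a b m : R) (F G f g : R -> R) :
  (forall t, t \in `[a, b] -> has_derive_within `[a, b] F t (f t)) ->
  (forall t, t \in `[a, b] -> has_derive_within `[a, b] G t (g t)) ->
  (forall t, t \in `[a, b] -> f t <= g t + m) ->
  forall s t, s \in `[a, b] -> t \in `[a, b] -> s <= t ->
    F t - F s <= G t - G s + m * (t - s).
Proof.
move=> hF hG fg s t sab tab st.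
have h u : u \in `[a, b] -> has_derive_within `[a, b]
    ((G \+ (fun t => 0 + m * t)) \- F) u (g u + m - f u).
  move=> uab; apply: has_derive_withinB; last exact: hF.
  by apply: has_derive_withinD; [exact: hG|exact: has_derive_within_affine].
have pos u : u \in `[a, b] -> 0 <= g u + m - f u by move=> /fg; rewrite subr_ge0.
by have := has_derive_within_ge0_homo h pos sab tab st => /=; lra.
Qed.

Lemma Ck_has_derive_within (R : realType) (k i : nat) (a b x : R) (f : R -> R) :
  Ck k a b f -> (i < k)%N -> x \in `[a, b] ->
  has_derive_within `[a, b] (derive_withinn `[a, b] i f) x
    (derive_withinn `[a, b] i.+1 f x).
Proof. by move=> [h _] ik xab; exact: h. Qed.

(** * Two-sided Taylor estimates of order four *)

(** [S 0], ..., [S 4] are a function and its successive derivatives on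
    [l, u]. The derivatives are data, since the fourth derivative of a spline
    error is only defined piece by piece. *)
Definition deriv_chain (R : realType) (l u : R) (S : nat -> R -> R) : Prop :=
  forall i t, (i < 4)%N -> t \in `[l, u] ->
    has_derive_within `[l, u] (S i) t (S i.+1 t).

(** A nonnegative fourth derivative propagates down a chain that vanishes at 0
    to order four. The third conclusion encodes the sign of the kernel
    (q - s)^2 q / 2 - (q - s)^3 / 2 without an integral: the function
    t S' - 3 S vanishes at 0 together with its first two derivatives, and its
    third derivative is t S''''. *)
Lemma chain4_ge0 (R : realType) (q : R) (S : nat -> R -> R) :
  0 <= q -> deriv_chain 0 q S -> (forall i, (i < 4)%N -> S i 0 = 0) ->
  (forall t, t \in `[0, q] -> 0 <= S 4 t) ->
  [/\ 0 <= S 0 q, 0 <= S 1 q & 3 * S 0%N q <= q * S 1%N q].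
Proof.
move=> q0 hS S0 S4.
have qq : q \in `[0, q] by rewrite in_itv/= q0 lexx.
have S3 : forall t, t \in `[0, q] -> 0 <= S 3 t.
  by apply: (derive_ge0_ge0 (S' := S 4)) => [t tq||//]; [exact: hS|exact: S0].
have S2 : forall t, t \in `[0, q] -> 0 <= S 2 t.
  by apply: (derive_ge0_ge0 (S' := S 3)) => [t tq||//]; [exact: hS|exact: S0].
have S1 : forall t, t \in `[0, q] -> 0 <= S 1 t.
  by apply: (derive_ge0_ge0 (S' := S 2)) => [t tq||//]; [exact: hS|exact: S0].
have S0' : forall t, t \in `[0, q] -> 0 <= S 0 t.
  by apply: (derive_ge0_ge0 (S' := S 1)) => [t tq||//]; [exact: hS|exact: S0].
pose D (i : nat) (c : R) t := t * S i.+1 t - c * S i t.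
have hD i c t : (i < 3)%N -> t \in `[0, q] ->
    has_derive_within `[0, q] (D i c) t (D i.+1 (c - 1) t).
  move=> i3 tq; rewrite /D.
  rewrite (_ : _ - _ = t * S i.+2 t + S i.+1 t - c * S i.+1 t); last ring.
  apply: has_derive_withinB.
    by apply: has_derive_within_mulid; apply: hS.
  by apply: has_derive_withinZ; apply: hS => //; exact: ltnW.
have D0 i c : (i < 3)%N -> D i c 0 = 0.
  by move=> i3; rewrite /D !S0//= ?mulr0 ?subrr//; exact: ltnW.
have D3 t : t \in `[0, q] -> 0 <= D 3%N (3 - 1 - 1 - 1) t.
  move=> tq; rewrite /D (_ : 3 - 1 - 1 - 1 = 0 :> R); last by ring.
  rewrite mul0r subr0 mulr_ge0 ?S4//.
  by move: tq; rewrite in_itv/= => /andP[].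
have D2 := derive_ge0_ge0 (fun t => @hD 2 _ t isT) (@D0 2 _ isT) D3.
have D1 := derive_ge0_ge0 (fun t => @hD 1 _ t isT) (@D0 1 _ isT) D2.
have := derive_ge0_ge0 (fun t => @hD 0 _ t isT) (@D0 0 _ isT) D1 qq.
by rewrite /D subr_ge0 => ?; split; rewrite ?S0' ?S1.
Qed.

(** Each bound is attained by W t = M t^4 / 24: the function M t^4 / 24 plus or
    minus the Taylor remainder of W satisfies the hypotheses of
    [chain4_ge0]. *)
Lemma taylor4 (R : realType) (q M : R) (W : nat -> R -> R) :
  0 <= q -> deriv_chain 0 q W -> (forall t, t \in `[0, q] -> `|W 4 t| <= M) ->
  let R0 := W 0%N q -
    (W 0%N 0 + W 1%N 0 * q + W 2 0 / 2 * q ^+ 2 + W 3 0 / 6 * q ^+ 3) in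
  let R1 := W 1%N q - (W 1%N 0 + W 2 0 * q + W 3 0 / 2 * q ^+ 2) in
  [/\ `|R0| <= M / 24 * q ^+ 4, `|R1| <= M / 6 * q ^+ 3 &
      `|q * R1 - 3 * R0| <= M / 24 * q ^+ 4].
Proof.
move=> q0 hW W4 R0 R1.
(* The signs s = 1 and s = -1 give the two sides of each absolute value. *)
suff key (s : R) : `|s| <= 1 -> [/\ 0 <= M / 24 * q ^+ 4 + s * R0,
    0 <= M / 6 * q ^+ 3 + s * R1 &
    3 * (M / 24 * q ^+ 4 + s * R0) <= q * (M / 6 * q ^+ 3 + s * R1)].
  have n1 : `|1 : R| <= 1 by rewrite normr1.
  have n2 : `|-1 : R| <= 1 by rewrite normrN1.
  have [a1 a2 a3] := key _ n1; have [b1 b2 b3] := key _ n2.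
  by split; rewrite ler_norml; apply/andP; split; lra.
move=> s1.
(* M t^4 / 24 + s * (W t - its cubic Taylor polynomial), with derivatives. *)
pose S (i : nat) : R -> R := match i with
  | 0%N => fun t => (- (s * W 0%N 0) + (- (s * W 1%N 0)) * t +
      (- (s * W 2 0 / 2)) * t ^+ 2 + (- (s * W 3 0 / 6)) * t ^+ 3 +
      M / 24 * t ^+ 4) + s * W 0%N t
  | 1%N => fun t => (- (s * W 1%N 0) + (2 * - (s * W 2 0 / 2)) * t +
      (3 * - (s * W 3 0 / 6)) * t ^+ 2 + (4 * (M / 24)) * t ^+ 3 +
      0 * t ^+ 4) + s * W 1%N t
  | 2%N => fun t => (2 * - (s * W 2 0 / 2) +
      (2 * (3 * - (s * W 3 0 / 6))) * t + (3 * (4 * (M / 24))) * t ^+ 2 +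
      (4 * 0) * t ^+ 3 + 0 * t ^+ 4) + s * W 2 t
  | 3%N => fun t => (2 * (3 * - (s * W 3 0 / 6)) +
      (2 * (3 * (4 * (M / 24)))) * t + (3 * (4 * 0)) * t ^+ 2 +
      (4 * 0) * t ^+ 3 + 0 * t ^+ 4) + s * W 3 t
  | _ => fun t => (2 * (3 * (4 * (M / 24))) + (2 * (3 * (4 * 0))) * t +
      (3 * (4 * 0)) * t ^+ 2 + (4 * 0) * t ^+ 3 + 0 * t ^+ 4) + s * W 4 t
  end.
have hS : deriv_chain 0 q S.
  move=> i t i4 tq; have hs := has_derive_withinZ (c := s) (hW i t i4 tq).
  by case: i i4 hs => [|[|[|[|//]]]] _ hs;
    apply: has_derive_withinD hs; exact: has_derive_within_quartic.
have S0 i : (i < 4)%N -> S i 0 = 0.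
  by case: i => [|[|[|[|//]]]] _ /=; field.
have S4 t : t \in `[0, q] -> 0 <= S 4%N t.
  move=> /W4 W4t /=.
  have : `|s * W 4 t| <= M by rewrite normrM (le_trans _ W4t)// ler_piMl.
  by rewrite ler_norml => /andP[? ?]; lra.
have [] := chain4_ge0 q0 hS S0 S4.
rewrite /= => h1 h2 h3; rewrite /R0 /R1; split.
- by lra.
- by lra.
- by lra.
Qed.

(** * Interpolation error of the slope *)

(** W and Z are the error e followed from its critical slope m to the right and
    to the left, over the distances q and p to the ends of the piece; hence the
    alternating signs of the derivatives at 0. With c the third derivative at 0,
    e (xi + q) = e (xi - p) says m (p + q) = - c (p^3 + q^3) / 6 + remainders, and
    e' (xi + q) >= - m says - c q^2 / 2 <= 2 m + remainder. Eliminating c leaves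
    m (p + q) (q^2 + 2 p (q - p)) <= M (q^6 + 4 p^3 q^3 + 3 p^4 q^2) / 24, in
    which p <= q makes the constant 1/24 come out. *)
Lemma far_end_bound (R : realType) (p q M m : R) (W Z : nat -> R -> R) :
  0 <= p -> p <= q -> 0 < q -> deriv_chain 0 q W -> deriv_chain 0 p Z ->
  (forall t, t \in `[0, q] -> `|W 4 t| <= M) ->
  (forall t, t \in `[0, p] -> `|Z 4 t| <= M) ->
  Z 0%N 0 = W 0%N 0 -> W 1%N 0 = m -> Z 1%N 0 = - m -> W 2 0 = 0 -> Z 2 0 = 0 ->
  Z 3 0 = - W 3 0 -> W 0%N q = 0 -> Z 0%N p = 0 -> - m <= W 1%N q -> 0 <= m ->
  m <= M / 24 * (p + q) ^+ 3.
Proof.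
move=> p0 pq q0 hW hZ W4 Z4 Z00 W10 Z10 W20 Z20 Z30 Wq Zp Wm m0.
have M0 : 0 <= M by rewrite (le_trans _ (W4 0 _))// in_itv/= lexx ltW.
have [_] := taylor4 (ltW q0) hW W4.
have [+ _ _] := taylor4 p0 hZ Z4.
rewrite Z00 W10 Z10 W20 Z20 Z30 Wq Zp; set e0 := W 0%N 0; set c := W 3 0.
rewrite !mul0r !addr0 => HZ.
set R0 := 0 - (e0 + m * q + _).
set R1 := W 1%N q - _ => HR1 HR.
(* The two values of e at the ends, subtracted, eliminate e0. *)
have E1 : m * (p + q) = - c / 6 * (p ^+ 3 + q ^+ 3)
   - R0 + (0 - (e0 + - m * p + - c / 6 * p ^+ 3)) by rewrite /R0; field.
set Rp := (0 - (e0 + - m * p + _)) in HZ E1.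
have HRp : Rp <= M / 24 * p ^+ 4 by apply: le_trans (ler_norm _) HZ.
have {}HR1 : R1 <= M / 6 * q ^+ 3 by apply: le_trans (ler_norm _) HR1.
have {}HR : q * R1 - 3 * R0 <= M / 24 * q ^+ 4 by apply: le_trans (ler_norm _) HR.
have E2 : - c * q ^+ 2 <= 2 * (2 * m + R1) by rewrite /R1; lra.
have p30 : 0 <= p ^+ 3 by rewrite exprn_ge0.
have q30 : 0 <= q ^+ 3 by rewrite exprn_ge0// ltW.
have q20 : 0 < q ^+ 2 by rewrite exprn_gt0.
(* Everything is multiplied by q^2 to avoid dividing by it. *)
have K1 : - c * q ^+ 2 * (p ^+ 3 + q ^+ 3) <= 2 * (2 * m + R1) * (p ^+ 3 + q ^+ 3).
  by rewrite ler_wpM2r// addr_ge0.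
have K2 : p ^+ 3 * R1 <= p ^+ 3 * (M / 6 * q ^+ 3) by rewrite ler_wpM2l.
have K3 : q ^+ 2 * (q * R1 - 3 * R0) <= q ^+ 2 * (M / 24 * q ^+ 4).
  by rewrite ler_wpM2l// ltW.
have K4 : q ^+ 2 * Rp <= q ^+ 2 * (M / 24 * p ^+ 4) by rewrite ler_wpM2l// ltW.
have K5 : 3 * q ^+ 2 * (m * (p + q)) <= 2 * m * (p ^+ 3 + q ^+ 3)
    + p ^+ 3 * (M / 6 * q ^+ 3) + q ^+ 2 * (M / 24 * q ^+ 4)
    + 3 * q ^+ 2 * (M / 24 * p ^+ 4).
  rewrite E1; lra.
(* The coefficient of m once c is eliminated, with p^3 + q^3 factored. *)
have D0 : 0 < (p + q) * (q ^+ 2 + 2 * p * (q - p)).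
  rewrite mulr_gt0//; first by rewrite ltr_wpDl.
  by rewrite ltr_pwDl// !mulr_ge0// subr_ge0.
have K6 : m * ((p + q) * (q ^+ 2 + 2 * p * (q - p))) <=
  M / 24 * (4 * p ^+ 3 * q ^+ 3 + q ^+ 6 + 3 * q ^+ 2 * p ^+ 4) by lra.
rewrite -(ler_pM2r D0); apply: (le_trans K6).
rewrite -[leRHS]mulrA ler_wpM2l ?divr_ge0//.
have pos i j : 0 <= p ^+ i * q ^+ j by rewrite mulr_ge0// exprn_ge0// ltW.
have pqd : 0 <= q - p by rewrite subr_ge0.
have S1 : q ^+ 2 * (p + q) ^+ 4 <=
    (p + q) ^+ 3 * ((p + q) * (q ^+ 2 + 2 * p * (q - p))).
  have spq : 0 <= p + q by lra.
  rewrite mulrA -exprSr mulrC ler_wpM2l ?exprn_ge0//.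
  by rewrite lerDl !mulr_ge0.
apply: le_trans S1.
have -> : q ^+ 2 * (p + q) ^+ 4 = 4 * p ^+ 3 * q ^+ 3 + q ^+ 6 + p ^+ 4 * q ^+ 2
   + 4 * (p ^+ 1 * q ^+ 5) + 6 * (p ^+ 2 * q ^+ 4) by ring.
have : p ^+ 4 * q ^+ 2 <= p ^+ 2 * q ^+ 4.
  rewrite (_ : p ^+ 4 * q ^+ 2 = p ^+ 2 * q ^+ 2 * p ^+ 2); last ring.
  rewrite (_ : p ^+ 2 * q ^+ 4 = p ^+ 2 * q ^+ 2 * q ^+ 2); last ring.
  by rewrite ler_wpM2l// lerXn2r// nnegrE// ltW.
by have := pos 1%N 5%N; have := pos 2%N 4%N; lra.
Qed.

(** The maximum of the slope error on one piece. Going right and left from xi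
    turns the piece into two chains from 0; reflecting the piece, and changing
    the sign so that the slope stays positive, makes the right side the longer
    one. *)
Lemma interior_max_bound (R : realType) (al be xi M : R) (E : nat -> R -> R) :
  al < be -> xi \in `[al, be] ->
  deriv_chain al be E ->
  (forall t, t \in `[al, be] -> `|E 4 t| <= M) ->
  E 0%N al = 0 -> E 0%N be = 0 -> E 2 xi = 0 -> 0 <= E 1%N xi ->
  - E 1%N xi <= E 1%N al -> - E 1%N xi <= E 1%N be ->
  E 1%N xi <= M / 24 * (be - al) ^+ 3.
Proof.
move=> albe; rewrite in_itv/= => /andP[alxi xibe] hE E4 Eal Ebe E2 E1 h1 h2.
(* tau is the overall sign and s the direction of travel. *)
pose V (tau s : R) (i : nat) t := tau * s ^+ i * E i (xi + s * t).
have inR t : t \in `[0, be - xi] -> xi + 1 * t \in `[al, be].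
  by rewrite !in_itv/= => /andP[? ?]; apply/andP; split; lra.
have inL t : t \in `[0, xi - al] -> xi + -1 * t \in `[al, be].
  by rewrite !in_itv/= => /andP[? ?]; apply/andP; split; lra.
have hV tau s q : (forall t, t \in `[0, q] -> xi + s * t \in `[al, be]) ->
    deriv_chain 0 q (V tau s).
  move=> sub i t i4 tq; rewrite /V.
  rewrite (_ : tau * s ^+ i.+1 * _ =
    tau * s ^+ i * (s * E i.+1 (xi + s * t))); last first.
    by rewrite exprS; ring.
  apply: has_derive_withinZ.
  apply: (has_derive_within_comp_affine (A := `[al, be]) (f := E i)).
    exact: sub.
  exact: hE (sub _ tq).
have V4 tau s q : (forall t, t \in `[0, q] -> xi + s * t \in `[al, be]) ->
    `|tau * s ^+ 4| = 1 -> forall t, t \in `[0, q] -> `|V tau s 4 t| <= M.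
  by move=> sub ts t tq; rewrite /V normrM ts mul1r E4//; exact: sub.
have eR : xi + 1 * (be - xi) = be by ring.
have eL : xi + -1 * (xi - al) = al by ring.
have [le|lt] := leP (xi - al) (be - xi).
- rewrite (_ : be - al = (xi - al) + (be - xi)); last ring.
  apply: (@far_end_bound _ _ _ _ _ (V 1 1) (V 1 (-1))) => //.
  + by rewrite subr_ge0.
  + lra.
  + exact: hV.
  + exact: hV.
  + by apply: V4 => //; rewrite mul1r expr1n normr1.
  + by apply: V4 => //; rewrite mul1r normrX normrN1 expr1n.
  + by rewrite /V !mulr0.
  + by rewrite /V !mulr0 addr0 expr1n !mul1r.
  + by rewrite /V !mulr0 addr0; ring.
  + by rewrite /V !mulr0 addr0 E2 mulr0.
  + by rewrite /V !mulr0 addr0 E2 mulr0.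
  + by rewrite /V !mulr0 addr0; ring.
  + by rewrite /V eR Ebe mulr0.
  + by rewrite /V eL Eal mulr0.
  + by rewrite /V eR expr1n !mul1r.
- rewrite (_ : be - al = (be - xi) + (xi - al)); last ring.
  apply: (@far_end_bound _ _ _ _ _ (V (-1) (-1)) (V (-1) 1)) => //.
  + by rewrite subr_ge0.
  + exact: ltW.
  + lra.
  + exact: hV.
  + exact: hV.
  + by apply: V4 => //; rewrite normrM normrX normrN1 expr1n mulr1.
  + by apply: V4 => //; rewrite normrM normrX normrN1 normr1 expr1n mulr1.
  + by rewrite /V !mulr0.
  + by rewrite /V !mulr0 addr0; ring.
  + by rewrite /V !mulr0 addr0; ring.
  + by rewrite /V !mulr0 addr0 E2 mulr0.
  + by rewrite /V !mulr0 addr0 E2 mulr0.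
  + by rewrite /V !mulr0 addr0; ring.
  + by rewrite /V eL Eal mulr0.
  + by rewrite /V eR Ebe mulr0.
  + by rewrite /V eL expr1 mulrNN mulr1 mul1r.
Qed.

(** All that the maximum argument knows about a spline error near x: v is the
    slope of an error E 0 which vanishes at both ends of a short subinterval and
    whose fourth derivative is bounded there. The chain depends on the piece
    because the third derivative of the error jumps at the nodes. *)
Definition piece_around (R : realType) (a b M h : R) (v : R -> R) (x : R) : Prop :=
  exists al be (E : nat -> R -> R),
    [/\ [/\ al < be, a <= al, be <= b & be - al <= h], x \in `[al, be],
      deriv_chain al be E /\ (forall t, t \in `[al, be] -> `|E 4 t| <= M),
      E 0%N al = 0 /\ E 0%N be = 0 &
      forall t, t \in `[al, be] -> E 1%N t = v t].

(** At the maximum point the derivative of v vanishes by Fermat's theorem. When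
    that point is a node, this still holds because v is differentiable across
    the nodes, and any adjacent piece will do. *)
Lemma derivative_bound_at_max (R : realType) (a b M h : R) (v v2 : R -> R) :
  a < b ->
  (forall x, x \in `[a, b] -> has_derive_within `[a, b] v x (v2 x)) ->
  v a = 0 -> v b = 0 ->
  (forall x, x \in `[a, b] -> piece_around a b M h v x) ->
  forall xi, xi \in `[a, b] -> (forall x, x \in `[a, b] -> `|v x| <= v xi) ->
  v xi <= M / 24 * h ^+ 3.
Proof.
move=> ab hv va vb pieces xi xiab vmax.
have [al [be [E [[albe aal beb hh] xialbe [hE E4] [Eal Ebe] Ev]]]] := pieces _ xiab.
have sub t : t \in `[al, be] -> t \in `[a, b].
  by rewrite !in_itv/= => /andP[? ?]; apply/andP; split; lra.
have alab : al \in `[al, be] by rewrite in_itv/= lexx ltW.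
have beab : be \in `[al, be] by rewrite in_itv/= lexx andbT ltW.
have M0 : 0 <= M by rewrite (le_trans _ (E4 al _)).
have vxi0 : 0 <= v xi by rewrite (le_trans _ (vmax _ xiab)).
have hpow : M / 24 * (be - al) ^+ 3 <= M / 24 * h ^+ 3.
  rewrite ler_wpM2l ?divr_ge0// lerXn2r// nnegrE ?subr_ge0 ?(ltW albe)//.
  by rewrite (le_trans _ hh)// subr_ge0 ltW.
apply: le_trans hpow.
move: vxi0; rewrite le_eqVlt => /predU1P[<-|vxi0].
  by rewrite mulr_ge0 ?divr_ge0 ?exprn_ge0// subr_ge0 ltW.
have xioo : xi \in `]a, b[.
  move: (xiab); rewrite !in_itv/= => /andP[axi xib].
  rewrite !lt_neqAle axi xib !andbT; apply/andP; split; apply/eqP => eq.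
  - by move: vxi0; rewrite -eq va ltxx.
  - by move: vxi0; rewrite eq vb ltxx.
have isd t : t \in `]a, b[ -> is_derive t 1 v (v2 t).
  move=> tab; apply: (@has_derive_within_is_derive _ `[a, b]).
    by apply: filterS (near_in_itvoo tab) => z; exact: subset_itv_oo_cc.
  by apply: hv; exact: subset_itv_oo_cc tab.
have v20 : v2 xi = 0.
  have [_ <-] := isd _ xioo.
  have drv t : t \in `]a, b[ -> derivable v t 1.
    by move=> /isd -[].
  by have [] := derive1_at_max (ltW ab) drv xioo
    (fun t tab => le_trans (ler_norm _) (vmax t (subset_itv_oo_cc tab))).
have E2 : E 2 xi = 0.
  rewrite -v20; apply: (has_derive_within_unique albe xialbe (hE 1%N xi isT xialbe)).
  apply: (eq_has_derive_within (f := v)) => //.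
    by move=> t; rewrite inE/= => tab; rewrite Ev.
  by apply: has_derive_within_subset (hv _ xiab) => t /=; exact: sub.
have low t : t \in `[al, be] -> - E 1%N xi <= E 1%N t.
  by move=> tab; rewrite !Ev// lerNl (le_trans (ler_norm _))// normrN vmax ?sub.
rewrite -Ev//; apply: interior_max_bound => //; last 2 first.
- exact: low.
- exact: low.
- by rewrite Ev// ltW.
Qed.

Lemma derivative_bound (R : realType) (a b M h : R) (v v2 : R -> R) :
  a < b ->
  (forall x, x \in `[a, b] -> has_derive_within `[a, b] v x (v2 x)) ->
  v a = 0 -> v b = 0 ->
  (forall x, x \in `[a, b] -> piece_around a b M h v x) ->
  forall x, x \in `[a, b] -> `|v x| <= M / 24 * h ^+ 3.
Proof.
move=> ab hv va vb pieces x xab.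
have cv : {within `[a, b], continuous (fun x => `|v x|)}.
  have := has_derive_within_continuous hv => cv y.
  apply: continuous_comp; first exact: cv.
  exact: norm_continuous.
have [xi xiab vmax] := EVT_max (ltW ab) cv.
apply: le_trans (vmax _ xab) _.
have [v0|v0] := leP 0 (v xi).
  rewrite ger0_norm//; apply: derivative_bound_at_max pieces _ xiab _ => //.
    exact: hv.
  by move=> t tab; rewrite -{1}(ger0_norm v0) vmax.
rewrite ltr0_norm//; apply: (@derivative_bound_at_max _ a b M h (\- v) (\- v2)) => //.
- by move=> t tab; exact/has_derive_withinN/hv.
- by rewrite /= va oppr0.
- by rewrite /= vb oppr0.
- move=> t /pieces[al [be [E [h1 h2 [hE E4] [Eal Ebe] Ev]]]].
  exists al, be, (fun i => \- E i); split => //.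
  + split=> [i s i4 /(hE i s i4)|s /E4]; first exact: has_derive_withinN.
    by rewrite /= normrN.
  + by rewrite /= Eal Ebe oppr0.
  + by move=> s /Ev /= ->.
- by move=> t tab; rewrite /= normrN -(ltr0_norm v0) vmax.
Qed.

Lemma exists_piece (R : realType) (a b x : R) (s : seq R) :
  a < b -> itv_partition a b s -> x \in `[a, b] ->
  exists2 k, (k < size s)%N & x \in `[node a b s k, node a b s k.+1].
Proof.
elim: s a => [a ab /itv_partition_nil ab'|y s ih a ab].
  by move: ab; rewrite ab' ltxx.
move=> hs; rewrite in_itv/= => /andP[ax xb].
have hs' := itv_partition_cons hs.
have [xy|yx] := leP x y.
  by exists 0%N; rewrite // /node/= in_itv/= ax.
have yb : y < b by exact: lt_le_trans xb.
have [|k ks xk] := ih y yb hs'; first by rewrite in_itv/= ltW.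
by exists k.+1.
Qed.

(** Third and fourth derivatives of F exist only on the pieces; they are taken
    to be those of the interpolating cubic, and the fourth one vanishes. *)
Lemma spline_derivative_error (R : realType) (a b M : R) (s : seq R) (F G : R -> R) :
  a < b -> itv_partition a b s -> Ck 4 a b G -> clamped_cubic_spline a b s G F ->
  (forall x, x \in `[a, b] -> `|derive_withinn `[a, b] 4 G x| <= M) ->
  forall x, x \in `[a, b] ->
  `|derive_within `[a, b] F x - derive_within `[a, b] G x| <=
    M / 24 * mesh a b s ^+ 3.
Proof.
move=> ab hs hG [hF hpoly hnode hFa hFb] hM x xab.
apply: (derivative_bound
  (v := fun x => derive_within `[a, b] F x - derive_within `[a, b] G x)
  (v2 := fun x => derive_withinn `[a, b] 2 F x - derive_withinn `[a, b] 2 G x)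
  ab) => //.
- move=> t tab; apply: has_derive_withinB.
    exact: (@Ck_has_derive_within _ _ 1 _ _ _ _ hF).
  exact: (@Ck_has_derive_within _ _ 1 _ _ _ _ hG).
- by rewrite hFa subrr.
- by rewrite hFb subrr.
move=> t tab; have [k ks tk] := exists_piece ab hs tab.
have [p sp Fp] := hpoly k ks.
set al := node a b s k; set be := node a b s k.+1.
have albe : al < be.
  have [/(pathP b) h _] := hs; exact: h.
have aal : a <= al by apply: itv_partition_nth_ge => //; exact: ltnW.
have beb : be <= b by apply: itv_partition_nth_le.
have sub u : u \in `[al, be] -> u \in `[a, b].
  by rewrite !in_itv/= => /andP[? ?]; apply/andP; split; lra.
have alab : al \in `[al, be] by rewrite in_itv/= lexx ltW.
have beab : be \in `[al, be] by rewrite in_itv/= lexx andbT ltW.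
have hGk i u : (i < 4)%N -> u \in `[al, be] ->
    has_derive_within `[al, be] (derive_withinn `[a, b] i G) u
      (derive_withinn `[a, b] i.+1 G u).
  move=> i4 ual; apply: has_derive_within_subset (Ck_has_derive_within hG i4 (sub _ ual)).
  by move=> z /=; exact: sub.
exists al, be, (fun i u => p^`(i).[u] - derive_withinn `[a, b] i G u); split.
- split => //; rewrite /mesh big_mkord.
  apply: le_trans (le_bigmax _ (fun i : 'I_(size s) =>
    `|node a b s i.+1 - node a b s i|) (Ordinal ks)).
  exact: ler_norm.
- exact: tk.
- split => [i u i4 ual|u ual].
    apply: has_derive_withinB; last exact: hGk.
    rewrite derivnS; exact: is_derive_has_derive_within.
  rewrite (derivn_poly0 sp) horner0 sub0r normrN.
  exact/hM/sub.
- by rewrite /= -!Fp ?hnode ?subrr ?(ltnW ks).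
- move=> u ual; congr (_ - _).
  apply/esym; apply: (has_derive_within_unique albe ual (f := F)).
    have := Ck_has_derive_within hF (isT : (0 < 2)%N) (sub _ ual).
    by apply: has_derive_within_subset => z /=; exact: sub.
  apply: (eq_has_derive_within (f := horner p)) => //.
    by move=> z; rewrite inE/= => zal; rewrite Fp.
  rewrite derivn1; exact: is_derive_has_derive_within.
Qed.

(** * The essential supremum norm of continuous functions *)

Lemma lebesgue_measure_setT_gt0 (R : realType) :
  (0 < @lebesgue_measure R [set: R])%E.
Proof.
apply: (@lt_le_trans _ _ (@lebesgue_measure R `]0, 1[%classic)).
  by rewrite lebesgue_measure_itv/= lte_fin ltr01 sube0 lte_fin.
by apply: le_measure; rewrite ?inE//; exact: measurable_itv.
Qed.

(** If |phi x| exceeded the essential supremum, it would do so on an interval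
    next to x, which has positive measure. *)
Lemma supnorm_ge (R : realType) (a b : R) (phi : R -> R) :
  a < b -> {within `[a, b], continuous phi} ->
  forall x, x \in `[a, b] -> (`|phi x|%:E <= supnorm a b phi)%E.
Proof.
move=> ab /subspace_continuousP cphi x xab.
rewrite leNgt; apply/negP; rewrite /supnorm.
have := Lnorm_ge0 (@lebesgue_measure R) +oo%E (EFin \o (phi \_ `[a, b])).

have := @ess_sup_ge _ _ _ (@lebesgue_measure R) (abse \o (EFin \o (phi \_ `[a, b]))).
rewrite unlock lebesgue_measure_setT_gt0.
set N := ess_sup _ _; case: N => [r|_ _|_]; rewrite ?leey//.
move=> ae r0 rphi; move: r0 rphi; rewrite lee_fin lte_fin => r0 rphi.
have e0 : 0 < `|phi x| - r by rewrite subr_gt0.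
have /cvgrPdist_lt/(_ _ e0) := cphi x xab.
rewrite near_withinE => /nbhs_ballP[d /= d0 hd].
set l := Num.max a (x - d); set u := Num.min b (x + d).
have lu : l < u.
  move: xab; rewrite in_itv/= /l /u => /andP[ax xb].
  by rewrite lt_min !gt_max; apply/andP; split; apply/andP; split; lra.
have neg : (@lebesgue_measure R).-negligible `]l, u[%classic.
  apply: negligibleS ae => t /=; rewrite in_itv/= /l /u gt_max lt_min.
  move=> /andP[/andP[ta' td] /andP[tb td']].
  have tab : `[a, b]%classic t by rewrite /= in_itv/= !ltW.
  rewrite patchE mem_set// lee_fin => tr.
  have : `|phi x - phi t| < `|phi x| - r.
    by apply: hd => //; rewrite /ball/= ltr_norml; apply/andP; split; lra.
  by have := lerB_dist (phi x) (phi t); lra.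
case: neg => B [mB B0 BI].
have : (lebesgue_measure (`]l, u[%classic : set R) <= 0)%E.
  by rewrite -B0; apply: le_measure; rewrite ?inE//; exact: measurable_itv.
by rewrite lebesgue_measure_itv/= lte_fin lu -EFinB lee_fin leNgt subr_gt0 lu.
Qed.

(** The end points form a null set. *)
Lemma supnorm_le (R : realType) (a b y : R) (phi : R -> R) : 0 <= y ->
  (forall x, x \in `]a, b[ -> `|phi x| <= y) -> (supnorm a b phi <= y%:E)%E.
Proof.
move=> y0 h; rewrite /supnorm unlock lebesgue_measure_setT_gt0.
apply/ess_supP; exists [set a; b]; split.
- by apply: measurableU; exact: measurable_set1.
- exact/countable_lebesgue_measure0/finite_set_countable/finite_set2.
move=> t /=; apply: contra_notP => /not_orP[/eqP ta /eqP tb].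
rewrite patchE; case: ifPn => [|_]; last by rewrite lee_fin normr0.
rewrite inE/= in_itv/= => /andP[ta' tb']; rewrite lee_fin h//.
by rewrite in_itv/= !lt_neqAle ta' tb' tb eq_sym ta.
Qed.

(** For a continuous function the essential supremum is a maximum. *)
Lemma supnorm_fin_num (R : realType) (a b : R) (phi : R -> R) :
  a < b -> {within `[a, b], continuous phi} ->
  exists2 r, supnorm a b phi = r%:E & exists2 x, x \in `[a, b] &
    r = `|phi x| /\ forall t, t \in `[a, b] -> `|phi t| <= r.
Proof.
move=> ab cphi.
have cn : {within `[a, b], continuous (fun x => `|phi x|)}.
  by move=> y; apply: continuous_comp; [exact: cphi|exact: norm_continuous].
have [x xab xmax] := EVT_max (ltW ab) cn.
exists `|phi x|; last by exists x.
apply/eqP; rewrite eq_le supnorm_ge// andbT supnorm_le// => t tab.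
exact/xmax/subset_itv_oo_cc.
Qed.

(** * Concave functions and supergradients *)

Lemma concave_onP (R : realType) (a b : R) (H : R -> R) :
  concave_on a b H <->
  forall x y c, x \in `[a, b] -> y \in `[a, b] -> 0 <= c -> c <= 1 ->
    c * H x + (1 - c) * H y <= H (c * x + (1 - c) * y).
Proof.
split => [h x y c xab yab c0 c1|h t x y]; last first.
  rewrite !inE/= => xab yab.
  have := h x y t%:num xab yab (ge0 t) (le1 t).
  by rewrite -lerN2 opprD -!mulrN; apply.
have xab' : x \in `[a, b]%classic by rewrite inE.
have yab' : y \in `[a, b]%classic by rewrite inE.
have := h (Itv01 c0 c1) x y xab' yab'.
rewrite !convRE /= -[_ + _ * y]/(c * x + (1 - c) * y) !mulrN -opprD lerN2.
exact.
Qed.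

(** These are the concave test functions of [lcm_increment_le]. *)
Lemma concave_on_affine_min (R : realType) (a b k q r s : R) : 0 <= r ->
  concave_on a b (fun t => k + q * t + r * Num.min t s).
Proof.
move=> r0; apply/concave_onP => x y c _ _ c0 c1.
have c1' : 0 <= 1 - c by rewrite subr_ge0.
suff : c * Num.min x s + (1 - c) * Num.min y s <= Num.min (c * x + (1 - c) * y) s.
  by move=> /(ler_wpM2l r0); lra.
have mx : Num.min x s <= x by rewrite ge_min lexx.
have my : Num.min y s <= y by rewrite ge_min lexx.
have mxs : Num.min x s <= s by rewrite ge_min lexx orbT.
have mys : Num.min y s <= s by rewrite ge_min lexx orbT.
rewrite le_min; apply/andP; split; first by rewrite lerD// ler_wpM2l.
rewrite [leRHS](_ : s = c * s + (1 - c) * s); last ring.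
by rewrite lerD// ler_wpM2l.
Qed.

Lemma concave_on_affine (R : realType) (a b k q : R) :
  concave_on a b (fun t => k + q * t).
Proof.
by apply/concave_onP => x y c _ _ _ _; rewrite le_eqVlt; apply/predU1P; left; ring.
Qed.

Definition supergradient (R : realType) (a b : R) (H : R -> R) (x p : R) :=
  forall t, t \in `[a, b] -> H t <= H x + p * (t - x).

Lemma concave_slopes (R : realType) (a b : R) (H : R -> R) (x y z : R) :
  concave_on a b H -> a <= x -> x < y -> y < z -> z <= b ->
  (H z - H y) * (y - x) <= (H y - H x) * (z - y).
Proof.
move=> /concave_onP cH ax xy yz zb.
have zx : 0 < z - x by lra.
have xab : x \in `[a, b] by rewrite in_itv/=; apply/andP; split; lra.
have zab : z \in `[a, b] by rewrite in_itv/=; apply/andP; split; lra.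
have c0 : 0 <= (z - y) / (z - x) by rewrite divr_ge0; lra.
have c1 : (z - y) / (z - x) <= 1 by rewrite ler_pdivrMr//; lra.
have := cH x z _ xab zab c0 c1.
have zx0 : z - x != 0 by rewrite gt_eqF.
rewrite (_ : _ * x + _ * z = y); last by field.
rewrite -(ler_pM2r zx).
rewrite (_ : (_ + _) * _ = (z - y) * H x + (y - x) * H z); last by field.
lra.
Qed.

(** The supremum of the slopes to the right of x works: it is finite because
    slopes to the left of x bound those to the right. *)
Lemma exists_supergradient (R : realType) (a b : R) (H : R -> R) (x : R) :
  concave_on a b H -> x \in `]a, b[ -> exists p, supergradient a b H x p.
Proof.
move=> cH; rewrite in_itv/= => /andP[ax xb].
pose S := [set (H t - H x) / (t - x) | t in `]x, b]].
have S0 : S !=set0.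
  exists ((H b - H x) / (b - x)); exists b => //=.
  by rewrite in_itv/= xb lexx.
have ub s : s \in `[a, x[ -> ubound S ((H x - H s) / (x - s)).
  rewrite in_itv/= => /andP[as_ sx] _ [t /= + <-]; rewrite in_itv/= => /andP[xt tb].
  have := concave_slopes cH as_ sx xt tb.
  by rewrite ler_pdivrMr ?subr_gt0// mulrAC ler_pdivlMr ?subr_gt0.
have hS : has_sup S.
  split => //; exists ((H x - H a) / (x - a)).
  by apply: ub; rewrite in_itv/= lexx.
exists (sup S) => t; rewrite in_itv/= => /andP[at_ tb].
have [tx|xt|->] := ltgtP t x; last by rewrite subrr mulr0 addr0.
- have : sup S <= (H x - H t) / (x - t).
    by apply: ge_sup => //; apply: ub; rewrite in_itv/= at_.
  by rewrite ler_pdivlMr ?subr_gt0//; lra.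
- have : (H t - H x) / (t - x) <= sup S.
    by apply: ub_le_sup; [exact: hS.2|exists t => //=; rewrite in_itv/= xt].
  by rewrite ler_pdivrMr ?subr_gt0//; lra.
Qed.

(** Neither p - e nor p + e is a supergradient, so some chord to the right of x
    has slope above p - e and some chord to the left has slope below p + e; by
    concavity all shorter chords share these bounds. *)
Lemma concave_derivable (R : realType) (a b : R) (H : R -> R) (x p : R) :
  concave_on a b H -> x \in `]a, b[ -> supergradient a b H x p ->
  (forall q, supergradient a b H x q -> q = p) ->
  has_derive_within `[a, b] H x p.
Proof.
move=> cH; rewrite in_itv/= => /andP[ax xb] hp uniq.
apply/has_derive_withinP => e e0.
have [t1 t1xb ht1] : exists2 t, x < t <= b & H x + (p - e) * (t - x) < H t.
  apply: contrapT => no; have : p - e = p.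
    apply: uniq => t tab; have := hp t tab.
    move: tab; rewrite in_itv/= => /andP[at_ tb].
    have [xt|tx] := ltP x t.
      by move=> _; rewrite leNgt; apply/negP => ?; apply: no; exists t; rewrite ?xt.
    by have : 0 <= e * (x - t) by [rewrite mulr_ge0 ?subr_ge0// ltW]; lra.
  lra.
have [t2 t2ax ht2] : exists2 t, a <= t < x & H x + (p + e) * (t - x) < H t.
  apply: contrapT => no; have : p + e = p.
    apply: uniq => t tab; have := hp t tab.
    move: tab; rewrite in_itv/= => /andP[at_ tb].
    have [tx|xt] := ltP t x.
      by move=> _; rewrite leNgt; apply/negP => ?; apply: no; exists t; rewrite ?at_.
    by have : 0 <= e * (t - x) by [rewrite mulr_ge0 ?subr_ge0// ltW]; lra.
  lra.
move: t1xb t2ax => /andP[xt1 t1b] /andP[at2 t2x].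
exists (Num.min (t1 - x) (x - t2)); first by rewrite lt_min !subr_gt0 xt1.
move=> t tab; have up := hp t tab.
rewrite lt_min => /andP[].
have [tx|xt|->] := ltgtP t x; last by rewrite !subrr mulr0 subrr normr0 mulr0.
- rewrite ltr0_norm ?subr_lt0// => _ tt2.
  have := concave_slopes cH at2 (_ : t2 < t) tx (ltW xb) => /(_ ltac:(lra)) sl.
  have K : (H x + (p + e) * (t2 - x) - H t) * (x - t) <= (H t2 - H t) * (x - t).
    by rewrite ler_wpM2r ?subr_ge0 ?(ltW tx)//; lra.
  have K2 : (H t - (H x + (p + e) * (t - x))) * (x - t2) >= 0 by lra.
  have K3 : 0 <= H t - (H x + (p + e) * (t - x)).
    by move: K2; rewrite pmulr_lge0// subr_gt0.
  by rewrite ler_norml; apply/andP; split; lra.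
- rewrite gtr0_norm ?subr_gt0// => tt1 _.
  have := concave_slopes cH (ltW ax) xt (_ : t < t1) t1b => /(_ ltac:(lra)) sl.
  have K : (H x + (p - e) * (t1 - x) - H t) * (t - x) <= (H t1 - H t) * (t - x).
    by rewrite ler_wpM2r ?subr_ge0 ?(ltW xt)//; lra.
  have K2 : (H t - (H x + (p - e) * (t - x))) * (t1 - x) >= 0 by lra.
  have K3 : 0 <= H t - (H x + (p - e) * (t - x)).
    by move: K2; rewrite pmulr_lge0// subr_gt0.
  by rewrite ler_norml; apply/andP; split; lra.
Qed.

(** * Least concave majorants *)

Definition bounded_above_on (R : realType) (a b : R) (F : R -> R) : Prop :=
  exists k, forall t, t \in `[a, b] -> F t <= k.

Section least_concave_majorant.
Context (R : realType) (a b : R) (F : R -> R).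
Let Fhat := least_concave_majorant a b F.

Lemma lcm_le (H : R -> R) x : (forall t, t \in `[a, b] -> F t <= H t) ->
  concave_on a b H -> x \in `[a, b] -> Fhat x <= H x.
Proof.
move=> FH cH xab; apply: ge_inf; last by exists H.
by exists (F x) => _ [K [FK _] <-]; exact: FK.
Qed.

Hypothesis Fbnd : bounded_above_on a b F.

Lemma majorants_nonempty x : [set H x | H in [set H : R -> R |
    (forall t, t \in `[a, b] -> F t <= H t) /\ concave_on a b H]] !=set0.
Proof.
have [k hk] := Fbnd; exists (k + 0 * x); exists (fun t => k + 0 * t) => //=.
split; last exact: concave_on_affine.
by move=> t /hk; rewrite mul0r addr0.
Qed.

Lemma le_lcm x : x \in `[a, b] -> F x <= Fhat x.
Proof.
move=> xab; apply: lb_le_inf; first exact: majorants_nonempty.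
by move=> _ [K [FK _] <-]; exact: FK.
Qed.

Lemma lcm_concave : concave_on a b Fhat.
Proof.
apply/concave_onP => x y c xab yab c0 c1.
apply: lb_le_inf; first exact: majorants_nonempty.
move=> _ [K [FK cK] <-].
apply: le_trans ((concave_onP _ _ _).1 cK _ _ _ xab yab c0 c1).
by apply: lerD; rewrite ler_wpM2l ?subr_ge0//; exact: lcm_le.
Qed.

End least_concave_majorant.

(** A corner of the majorant at x would leave room below it. Where F touches
    the majorant, the derivative of F would be at most p and at least q > p.
    Where F stays below, a line of slope (p + q) / 2 passing slightly under the
    corner is still a majorant of F, which contradicts minimality. *)
Lemma lcm_supergradient_nlt (R : realType) (a b : R) (F : R -> R) (x l p q : R) :
  bounded_above_on a b F ->
  x \in `]a, b[ -> has_derive_within `[a, b] F x l ->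
  supergradient a b (least_concave_majorant a b F) x p ->
  supergradient a b (least_concave_majorant a b F) x q -> ~ p < q.
Proof.
move=> Fb xab dF; set Fh := least_concave_majorant a b F => hp hq pq.
have xab' : x \in `[a, b] by exact: subset_itv_oo_cc xab.
have up r t : supergradient a b Fh x r -> t \in `[a, b] -> F t <= Fh x + r * (t - x).
  by move=> hr tab; apply: le_trans (hr t tab); exact: le_lcm.
move: (xab); rewrite in_itv/= => /andP[ax xb].
move/has_derive_withinP in dF.
have := le_lcm Fb xab'; rewrite -/Fh le_eqVlt => /predU1P[FE|Flt].
(* F touches its majorant at x. *)
- have e0 : 0 < (q - p) / 4 by lra.
  have [d d0 hd] := dF _ e0.
  pose r := Num.min (d / 2) (Num.min (b - x) (x - a)).
  have r0 : 0 < r by rewrite !lt_min divr_gt0// !subr_gt0 xb.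
  have rd : r < d by rewrite gt_min; apply/orP; left; lra.
  have rb : r <= b - x by rewrite !ge_min lexx !orbT.
  have ra : r <= x - a by rewrite !ge_min lexx !orbT.
  have tR : x + r \in `[a, b] by rewrite in_itv/=; apply/andP; split; lra.
  have tL : x - r \in `[a, b] by rewrite in_itv/=; apply/andP; split; lra.
  have aR : x + r - x = r by ring.
  have aL : x - r - x = - r by ring.
  have := hd _ tR; rewrite aR gtr0_norm// => /(_ rd).
  rewrite ler_norml => /andP[hR _].
  have := hd _ tL; rewrite aL normrN gtr0_norm// => /(_ rd).
  rewrite ler_norml => /andP[hL _].
  have := up _ _ hp tR; have := up _ _ hq tL; rewrite aR aL -FE => u1 u2.
  have : 0 < (q - p) * r by rewrite mulr_gt0// subr_gt0.
  lra.
(* F is below its majorant at x: e is small enough for the lowered line to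
   clear F near x by continuity, and away from x by the gap of size
   (q - p) / 2 * |t - x| between the line and the two tangents. *)
- have [d d0 hd] := dF 1 ltr01.
  pose m := (p + q) / 2.
  pose K := `|l| + 1 + `|m|.
  have K0 : 0 < K by rewrite /K; have := normr_ge0 l; have := normr_ge0 m; lra.
  pose g := Fh x - F x.
  have g0 : 0 < g by rewrite subr_gt0.
  pose de := Num.min d (g / 2 / K).
  have de0 : 0 < de by rewrite lt_min d0 !divr_gt0.
  have ded : de <= d by rewrite ge_min lexx.
  have deK : K * de <= g / 2.
    by rewrite mulrC -ler_pdivlMr// ge_min lexx orbT.
  pose e := Num.min (g / 2) ((q - p) / 2 * de).
  have e0 : 0 < e.
    by rewrite lt_min !divr_gt0//= mulr_gt0// divr_gt0// subr_gt0.
  have eg : e <= g / 2 by rewrite ge_min lexx.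
  have eq' : e <= (q - p) / 2 * de by rewrite ge_min lexx orbT.
  suff : Fh x <= (Fh x - e - m * x) + m * x by lra.
  apply: (lcm_le (H := fun t => (Fh x - e - m * x) + m * t)) => //.
    2: exact: concave_on_affine.
  move=> t tab.
  have [near|far] := ltP `|t - x| de.
    have := hd t tab (lt_le_trans near ded); rewrite mul1r => h1.
    have h2 : `|l * (t - x)| + `|t - x| + `|m * (t - x)| <= g / 2.
      apply: le_trans deK; rewrite (normrM l) (normrM m).
      have : K * `|t - x| <= K * de by rewrite ler_wpM2l// ltW.
      by rewrite /K; lra.
    have h3 := ler_norm (F t - F x - l * (t - x)).
    have h4 := ler_norm (l * (t - x)).
    have h5 := ler_norm (- (m * (t - x))); rewrite normrN in h5.
    have gE : g = Fh x - F x by [].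
    by clearbody g m; lra.
  have u1 := up _ _ hp tab; have u2 := up _ _ hq tab.
  have u3 : (q - p) / 2 * de <= (q - p) / 2 * `|t - x| by rewrite ler_wpM2l//; lra.
  have [xt|tx] := leP x t.
    by move: u3; rewrite ger0_norm ?subr_ge0// /m; lra.
  by move: u3; rewrite ltr0_norm ?subr_lt0// /m; lra.
Qed.

Lemma lcm_derivable (R : realType) (a b : R) (F : R -> R) (x l : R) :
  bounded_above_on a b F ->
  x \in `]a, b[ -> has_derive_within `[a, b] F x l ->
  exists p, has_derive_within `[a, b] (least_concave_majorant a b F) x p.
Proof.
move=> Fb xab dF.
have [p hp] := exists_supergradient (lcm_concave Fb) xab.
exists p; apply: concave_derivable => // [|q hq]; first exact: lcm_concave.
have n1 := lcm_supergradient_nlt Fb xab dF hp hq.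
have n2 := lcm_supergradient_nlt Fb xab dF hq hp.
by apply/eqP; rewrite eq_le !leNgt; apply/andP; split; apply/negP.
Qed.

(** The comparison principle: if H - F is nondecreasing, so is the difference of
    the majorants. The proof bounds F t + H s by a function that is concave in
    each variable separately and whose value at (t, s) = (y, x) is the majorant
    of F at x plus that of H at y. *)
Lemma lcm_increment_le (R : realType) (a b : R) (F H : R -> R) :
  bounded_above_on a b F ->
  bounded_above_on a b H ->
  (forall s t, s \in `[a, b] -> t \in `[a, b] -> s <= t -> F t - F s <= H t - H s) ->
  forall x y, x \in `]a, b[ -> y \in `]a, b[ -> x < y ->
  least_concave_majorant a b F y - least_concave_majorant a b F x <=
  least_concave_majorant a b H y - least_concave_majorant a b H x.
Proof.
move=> Fb Hb FH x y xab yab xy.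
have xab' : x \in `[a, b] by exact: subset_itv_oo_cc xab.
have yab' : y \in `[a, b] by exact: subset_itv_oo_cc yab.
set Fh := least_concave_majorant a b F; set Hh := least_concave_majorant a b H.
have [p hp] := exists_supergradient (lcm_concave Fb) xab.
have [q hq] := exists_supergradient (lcm_concave Hb) yab.
have [pq|qp] := leP p q.
  have := hp _ yab'; have := hq _ xab'; rewrite -/Fh -/Hh.
  have : p * (y - x) <= q * (y - x) by rewrite ler_wpM2r// subr_ge0 ltW.
  by lra.
have qp' : 0 <= p - q by lra.
pose C := Fh x + Hh y - p * x - q * y.
have upF t : t \in `[a, b] -> F t <= Fh x + p * (t - x).
  by move=> tab; apply: le_trans (hp t tab); exact: le_lcm.
have upH t : t \in `[a, b] -> H t <= Hh y + q * (t - y).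
  by move=> tab; apply: le_trans (hq t tab); exact: le_lcm.
(* For t <= s these are the tangent bounds; for s < t the monotonicity of H - F
   exchanges the roles of s and t first. *)
have key s t : s \in `[a, b] -> t \in `[a, b] ->
    F t + H s <= C + q * (s + t) + (p - q) * Num.min t s.
  move=> sab tab; have [ts|st] := leP t s.
    by have := upF _ tab; have := upH _ sab; rewrite /C; lra.
  have := FH _ _ sab tab (ltW st); have := upF _ sab; have := upH _ tab.
  by rewrite /C; lra.
have hFh s : s \in `[a, b] ->
    Fh y <= (C + q * s - H s) + q * y + (p - q) * Num.min y s.
  move=> sab.
  apply: (lcm_le (H := fun t =>
    (C + q * s - H s) + q * t + (p - q) * Num.min t s)) => //.
    by move=> t tab; have := key _ _ sab tab; lra.
  exact: concave_on_affine_min.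
have : Hh x <= (C + q * y - Fh y) + q * x + (p - q) * Num.min x y.
  apply: (lcm_le (H := fun s =>
    (C + q * y - Fh y) + q * s + (p - q) * Num.min s y)) => //.
    by move=> s sab; have := hFh _ sab; rewrite minC; lra.
  exact: concave_on_affine_min.
by rewrite min_l ?(ltW xy)// /C; lra.
Qed.

Lemma concave_onD_affine (R : realType) (a b k q : R) (H : R -> R) :
  concave_on a b H -> concave_on a b (fun t => H t + (k + q * t)).
Proof.
move=> /concave_onP cH; apply/concave_onP => x y c xab yab c0 c1.
by have := cH x y c xab yab c0 c1; lra.
Qed.

(** The majorant of H plus the affine function is a concave majorant of F. *)
Lemma lcmD_affine_le (R : realType) (a b k q x : R) (F H : R -> R) :
  bounded_above_on a b H ->
  (forall t, t \in `[a, b] -> F t <= H t + (k + q * t)) -> x \in `[a, b] ->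
  least_concave_majorant a b F x <= least_concave_majorant a b H x + (k + q * x).
Proof.
move=> Hb FH xab.
apply: (lcm_le (H := fun t => least_concave_majorant a b H t + (k + q * t))) => //.
  by move=> t tab; apply: le_trans (FH t tab) _; rewrite lerD2r; exact: le_lcm.
exact/concave_onD_affine/lcm_concave.
Qed.

Lemma bounded_above_onD_affine (R : realType) (a b k q : R) (H : R -> R) :
  bounded_above_on a b H -> bounded_above_on a b (fun t => H t + (k + q * t)).
Proof.
move=> [B hB]; exists (B + (k + `|q| * (`|a| + `|b|))) => t tab.
rewrite lerD ?hB// lerD2l (le_trans (ler_norm _))// normrM ler_wpM2l//.
move: tab; rewrite in_itv/= => /andP[at_ tb]; rewrite ler_norml.
have := ler_norm b; have := ler_norm (- a); rewrite normrN.
by have := normr_ge0 a; have := normr_ge0 b; move=> *; apply/andP; split; lra.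
Qed.

Lemma lcmD_affine (R : realType) (a b k q x : R) (H : R -> R) :
  bounded_above_on a b H -> x \in `[a, b] ->
  least_concave_majorant a b (fun t => H t + (k + q * t)) x =
  least_concave_majorant a b H x + (k + q * x).
Proof.
move=> Hb xab; apply/eqP; rewrite eq_le lcmD_affine_le//=.
have := @lcmD_affine_le _ a b (- k) (- q) x H _
  (bounded_above_onD_affine k q Hb) _ xab.
rewrite -lerBrDr => /(_ _)/le_trans; apply; last by lra.
by move=> t _; lra.
Qed.

(** [lcm_increment_le] with H t = G t + m t. *)
Lemma lcm_derivative_le (R : realType) (a b m x p q : R) (F G f g : R -> R) :
  bounded_above_on a b F -> bounded_above_on a b G ->
  (forall t, t \in `[a, b] -> has_derive_within `[a, b] F t (f t)) ->
  (forall t, t \in `[a, b] -> has_derive_within `[a, b] G t (g t)) ->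
  (forall t, t \in `[a, b] -> f t <= g t + m) ->
  x \in `]a, b[ ->
  has_derive_within `[a, b] (least_concave_majorant a b F) x p ->
  has_derive_within `[a, b] (least_concave_majorant a b G) x q ->
  p <= q + m.
Proof.
move=> Fb Gb hF hG fg xab hp hq.
have mono s t : s \in `[a, b] -> t \in `[a, b] -> s <= t ->
    F t - F s <= (G t + (0 + m * t)) - (G s + (0 + m * s)).
  by move=> sab tab st; have := increment_le hF hG fg sab tab st; lra.
rewrite -subr_ge0.
have d := has_derive_withinB
  (has_derive_withinD hq (@has_derive_within_affine _ `[a, b] 0 m x)) hp.
apply: (has_derive_within_ge0 xab d) => t tab xt /=.
have := lcm_increment_le Fb (bounded_above_onD_affine 0 m Gb) mono xab tab xt.
by rewrite !lcmD_affine//; [lra|exact: subset_itv_oo_cc..].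
Qed.

Lemma continuous_bounded_above_on (R : realType) (a b : R) (F : R -> R) :
  a < b -> {within `[a, b], continuous F} -> bounded_above_on a b F.
Proof. by move=> ab /(EVT_max (ltW ab))[c _ h]; exists (F c). Qed.

Lemma lcm_derivative_dist (R : realType) (a b m x : R) (F G f g : R -> R) :
  a < b ->
  (forall t, t \in `[a, b] -> has_derive_within `[a, b] F t (f t)) ->
  (forall t, t \in `[a, b] -> has_derive_within `[a, b] G t (g t)) ->
  (forall t, t \in `[a, b] -> `|f t - g t| <= m) ->
  x \in `]a, b[ ->
  `|derive_within `[a, b] (least_concave_majorant a b F) x -
    derive_within `[a, b] (least_concave_majorant a b G) x| <= m.
Proof.
move=> ab hF hG fg xab; have xab' := subset_itv_oo_cc xab.
have Fb := continuous_bounded_above_on ab (has_derive_within_continuous hF).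
have Gb := continuous_bounded_above_on ab (has_derive_within_continuous hG).
have [p hp] := lcm_derivable Fb xab (hF x xab').
have [q hq] := lcm_derivable Gb xab (hG x xab').
rewrite (has_derive_withinE ab xab' hp) (has_derive_withinE ab xab' hq).
have pq : p <= q + m.
  apply: lcm_derivative_le hp hq => // [||t /fg]; [exact: hF|exact: hG|].
  by rewrite ler_norml => /andP[_]; lra.
have qp : q <= p + m.
  apply: lcm_derivative_le hq hp => // [||t /fg]; [exact: hG|exact: hF|].
  by rewrite ler_norml => /andP[+ _]; lra.
by rewrite ler_norml; apply/andP; split; lra.
Qed.

(** Agreement at a and the bound on slopes give F <= G + m (t - a), and likewise
    F <= G + m (b - t) from b; both bounds are affine perturbations of G. *)
Lemma lcm_dist_ends (R : realType) (a b m x : R) (F G f g : R -> R) :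
  a < b ->
  (forall t, t \in `[a, b] -> has_derive_within `[a, b] F t (f t)) ->
  (forall t, t \in `[a, b] -> has_derive_within `[a, b] G t (g t)) ->
  (forall t, t \in `[a, b] -> f t <= g t + m) ->
  (forall t, t \in `[a, b] -> g t <= f t + m) ->
  F a = G a -> F b = G b -> x \in `[a, b] ->
  least_concave_majorant a b F x - least_concave_majorant a b G x <=
    m * Num.min (x - a) (b - x).
Proof.
move=> ab hF hG fg gf Fa Fb xab.
have Gbd := continuous_bounded_above_on ab (has_derive_within_continuous hG).
have aab : a \in `[a, b] by rewrite in_itv/= lexx ltW.
have bab : b \in `[a, b] by rewrite in_itv/= lexx andbT ltW.
have incr := increment_le hF hG fg.
have [_|_] := leP (x - a) (b - x).
  have : least_concave_majorant a b F x <=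
      least_concave_majorant a b G x + (- (m * a) + m * x).
    apply: lcmD_affine_le => // t tab; have := incr a t aab tab.
    by move: tab; rewrite in_itv/= => /andP[-> _] /(_ isT); lra.
  by lra.
have : least_concave_majorant a b F x <=
    least_concave_majorant a b G x + (m * b + (- m) * x).
  apply: lcmD_affine_le => // t tab; have := increment_le hG hF gf tab bab.
  by move: tab; rewrite in_itv/= => /andP[_ ->] /(_ isT); lra.
by lra.
Qed.

(** * Spline approximation of least concave majorants *)

Theorem theorem16 (R : realType) (a b : R) (hab : a < b)
    (rho : seq R) (hrho : itv_partition a b rho)
    (G : R -> R) (hG : Ck 4 a b G)
    (F : R -> R) (hF : clamped_cubic_spline a b rho G F) :
  let Fhat := least_concave_majorant a b F in
  let Ghat := least_concave_majorant a b G in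
  let f := derive_within `[a, b] F in
  let g := derive_within `[a, b] G in
  let fo := derive_within `[a, b] Fhat in
  let go := derive_within `[a, b] Ghat in
  let G4 := derive_withinn `[a, b] 4 G in
  [/\ (supnorm a b (fo \- go)%R <= supnorm a b (f \- g)%R)%E,
      (supnorm a b (f \- g)%R <=
         (24^-1)%:E * supnorm a b G4 * (mesh a b rho ^+ 3)%:E)%E &
      forall x, x \in `[a, b] ->
        (`|Fhat x - Ghat x|%:E <=
           (Num.min (x - a) (b - x) / 24)%:E * supnorm a b G4
             * (mesh a b rho ^+ 3)%:E)%E].
Proof.
move=> Fhat Ghat f g fo go G4.
have [M -> [x0 _ [M0 G4M]]] := supnorm_fin_num hab hG.2.
have fgM := spline_derivative_error hab hrho hG hF G4M.
have [hF2 _ hnode _ _] := hF.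
have dF t : t \in `[a, b] -> has_derive_within `[a, b] F t (f t).
  by move=> tab; exact: (Ck_has_derive_within hF2 (isT : (0 < 2)%N) tab).
have dG t : t \in `[a, b] -> has_derive_within `[a, b] G t (g t).
  by move=> tab; exact: (Ck_has_derive_within hG (isT : (0 < 4)%N) tab).
have cfg : {within `[a, b], continuous (f \- g)}.
  apply: (has_derive_within_continuous (f' := fun x =>
    derive_withinn `[a, b] 2 F x - derive_withinn `[a, b] 2 G x)) => t tab.
  apply: has_derive_withinB.
    exact: (Ck_has_derive_within hF2 (isT : (1 < 2)%N) tab).
  exact: (Ck_has_derive_within hG (isT : (1 < 4)%N) tab).
have [m -> [x1 x1ab [m0 fgm]]] := supnorm_fin_num hab cfg.
split.
- apply: supnorm_le => [|x xab]; first by rewrite m0.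
  exact: lcm_derivative_dist dF dG fgm xab.
- by rewrite -!EFinM lee_fin m0 [24^-1 * M]mulrC fgM.
- have Fa : F a = G a by exact: (hnode 0%N).
  have Fb : F b = G b.
    by have := hnode (size rho) (leqnn _);
      rewrite /node (itv_partition_nth_size _ hrho).
  set B := M / 24 * mesh a b rho ^+ 3 in fgM.
  have fgB t : t \in `[a, b] -> f t <= g t + B.
    by move=> /fgM; rewrite ler_norml => /andP[_]; rewrite lerBlDl.
  have gfB t : t \in `[a, b] -> g t <= f t + B.
    by move=> /fgM; rewrite ler_norml => /andP[+ _]; rewrite lerNl opprB lerBlDl.
  move=> x xab; rewrite -!EFinM lee_fin.
  rewrite (_ : _ * M * _ = B * Num.min (x - a) (b - x)); last by rewrite /B; field.
  have := lcm_dist_ends hab dF dG fgB gfB Fa Fb xab.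
  have := lcm_dist_ends hab dG dF gfB fgB (esym Fa) (esym Fb) xab.
  by rewrite -/Fhat -/Ghat ler_norml lerNl opprB => -> ->.
Qed.
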